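(* Let $(W,S)$ be a Coxeter system with length function $\ell$ and let $w,x\in W$. Let $[e,w]\,x^{-1}=\{vx^{-1}: v\le w\}$, partially ordered by the restriction of the Bruhat order of $W$. Then for all $u<v$ in $[e,w]\,x^{-1}$ there is a chain from $u$ to $v$ in $[e,w]\,x^{-1}$ of length $\ell(v)-\ell(u)$.
   Context: $(W,S)$ is a Coxeter system, not assumed finite, with identity $e$ and Bruhat order $\le$. A chain $u=c_0<c_1<\cdots<c_k=v$ has length $k$. *)

(* Defs.v *)
From HB Require Import structures.
From mathcomp Require Import all_boot.
From mathcomp Require Import boolp classical_sets.
From Stdlib Require Import Relations.Relation_Operators.

Set Implicit Arguments.
Unset Strict Implicit.
Unset Printing Implicit Defensive.

Local Open Scope classical_set_scope.
Local Open Scope group_scope.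

(* The value 0 of a Coxeter matrix encodes infinity. *)
Definition coxeter_matrix (W : Type) (S : set W) (m : W -> W -> nat) : Prop :=
  forall s t, S s -> S t -> (m s t = 1%N <-> s = t) /\ m s t = m t s.

(* For an infinite entry the relation reads (f s * f t) ^+ 0 = 1, hence is
   void, as it should be. *)
Definition coxeter_relations (W : Type) (S : set W) (m : W -> W -> nat)
    (G : groupType) (f : W -> G) : Prop :=
  forall s t, S s -> S t -> (f s * f t) ^+ m s t = 1.

Definition has_expression (W : groupType) (S : set W) (w : W) (k : nat) : Prop :=
  exists r : seq W,
    [/\ size r = k, {in r, forall s, S s} & \prod_(s <- r) s = w].

(* (W, S) is a Coxeter system when W is the group generated by S with defining
   relations (s t)^m(s,t) = 1; the presentation is expressed by its universal
   property, where only the values of f on S matter.  As the elements of S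
   are involutions, no inverses are needed in expressions. *)
Definition coxeter_system (W : groupType) (S : set W) : Prop :=
  exists m : W -> W -> nat,
    [/\ coxeter_matrix S m,
        coxeter_relations S m (fun s : W => s),
        forall w, exists k, has_expression S w k
      & forall (G : groupType) (f : W -> G), coxeter_relations S m f ->
          exists phi : {multiplicative W -> G}, forall s, S s -> phi s = f s].

(* The default value 0 is only used when w has no expression. *)
Definition coxeter_length (W : groupType) (S : set W) (w : W) : nat :=
  xget 0%N [set k | has_expression S w k /\
                    forall j, has_expression S w j -> (k <= j)%N].

Definition reflections (W : groupType) (S : set W) : set W :=
  [set t | exists w s, S s /\ t = w * s * w^-1].

Definition bruhat_step (W : groupType) (S : set W) (u v : W) : Prop :=
  (exists2 t, reflections S t & v = u * t) /\
  (coxeter_length S u < coxeter_length S v)%N.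

Definition bruhat_le (W : groupType) (S : set W) : W -> W -> Prop :=
  clos_refl_trans W (bruhat_step S).

Definition bruhat_lt (W : groupType) (S : set W) (u v : W) : Prop :=
  bruhat_le S u v /\ u <> v.

Definition translated_lower_interval (W : groupType) (S : set W) (w x : W) :
    set W :=
  [set v * x^-1 | v in [set v | bruhat_le S v w]].

Definition bruhat_chain (W : groupType) (S P : set W) (u v : W) (k : nat) :
    Prop :=
  exists c : nat -> W,
    [/\ c 0%N = u, c k = v,
        forall i, (i <= k)%N -> P (c i)
      & forall i, (i < k)%N -> bruhat_lt S (c i) (c i.+1)].

(* Main.v *)
Require Import Defs.
From HB Require Import structures.
From mathcomp Require Import all_boot.
From mathcomp Require Import zify.
From mathcomp Require Import boolp classical_sets.
From Stdlib Require Import Relations.Relation_Operators.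

(** Write l for the length.  An element c lies in [e,w] x^-1 exactly when
    c x <= w, so the task is to join u to v by a saturated chain, each step
    raising l by one, whose translates c x all stay below w.  Among the
    saturated chains from u to v in the whole group (there is one, by
    [bruhat_saturated_chain]) take one that minimizes the sum of the lengths
    l(c x) of its translates.

    Such a chain has no peak, that is no three successive terms a, c, b with
    a x < c x > b x: by [exchange_peak] the middle term of a peak can be
    replaced by some c' with l(c' x) < l(c x).  So the translates first go down
    and then up in Bruhat order.  Those of the first part are below u x, those
    of the second part are below v x, and both u x and v x are below w
    ([peak_free_below]).

    The exchange of a peak takes place in a dihedral group.  Let c = a t and
    b = c t' with reflections t and t'.  Multiplying an element by t on the
    right in a Bruhat-increasing way makes the translate by x go down exactly
    when t is a left inversion of x, i.e. l(t x) < l(x) ([translate_up]).  So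
    the peak says that t is not an inversion of x and that t' is one.  By
    Dyer's theory of reflection subgroups, the dihedral group generated by t and
    t' has two canonical generators p and q.  Inside this dihedral group the
    inversions of any element of W form an initial segment of one of the two
    sequences p, pqp, pqpqp, ... and q, qpq, qpqpq, ... ([inversion_alt]), and
    the length on a coset of the dihedral group strictly increases with the
    level, the number of these inversions ([len_levelS]).  The inverses of a, c
    and b lie on three successive levels, and c' is given by the second element
    of the level in the middle.  If c and c' were both peaks, the inversions of
    x would not be an initial segment ([dihedral_diamond]).

    Inversions are handled through the cocycle N(xy) = N(x) + x N(y) x^-1 for
    symmetric difference.  It is read off from a homomorphism of W into the
    semidirect product of W with the boolean functions on W, which the
    presentation of W provides ([simple_lift_extends]). *)

Set Implicit Arguments.
Unset Strict Implicit.
Unset Printing Implicit Defensive.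

Local Open Scope group_scope.

(** * The semidirect product of a group with its boolean functions *)

(** The second component of an element is a set of group elements, as its
    indicator function; sets are added by symmetric difference and the group
    acts on them by conjugation. *)
Definition twisted (W : groupType) : Type := (W * (W -> bool))%type.

Section TwistedProduct.
Variable W : groupType.

HB.instance Definition _ := Choice.on (twisted W).

Definition twisted_one : twisted W := (1, fun=> false).
Definition twisted_mul (x y : twisted W) : twisted W :=
  (x.1 * y.1, fun t => x.2 t (+) y.2 (x.1^-1 * t * x.1)).
Definition twisted_inv (x : twisted W) : twisted W :=
  (x.1^-1, fun t => x.2 (x.1 * t * x.1^-1)).

Lemma twisted_mulA : associative twisted_mul.
Proof.
move=> [x f] [y g] [z h]; rewrite /twisted_mul /= mulgA; congr pair.
by apply: funext => t; rewrite addbA invgM !mulgA.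
Qed.

Lemma twisted_mul1 : left_id twisted_one twisted_mul.
Proof.
move=> [x f]; rewrite /twisted_mul /= mul1g; congr pair.
by apply: funext => t; rewrite invg1 mul1g mulg1.
Qed.

Lemma twisted_mulr1 : right_id twisted_one twisted_mul.
Proof.
move=> [x f]; rewrite /twisted_mul /= mulg1; congr pair.
by apply: funext => t; rewrite addbF.
Qed.

Lemma twisted_mulV : left_inverse twisted_one twisted_inv twisted_mul.
Proof.
move=> [x f]; rewrite /twisted_mul /= mulVg; congr pair.
by apply: funext => t; rewrite invgK addbb.
Qed.

Lemma twisted_mulrV : right_inverse twisted_one twisted_inv twisted_mul.
Proof.
move=> [x f]; rewrite /twisted_mul /= mulgV; congr pair.
by apply: funext => t; rewrite !mulgA mulgV mul1g mulgK addbb.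
Qed.

HB.instance Definition _ := isGroup.Build (twisted W) twisted_mulA
  twisted_mul1 twisted_mulr1 twisted_mulV twisted_mulrV.

Lemma twisted_mulE (x y : twisted W) :
  x * y = (x.1 * y.1, fun t => x.2 t (+) y.2 (x.1^-1 * t * x.1)).
Proof. by []. Qed.

Lemma twisted_1E : (1 : twisted W) = (1, fun=> false).
Proof. by []. Qed.

End TwistedProduct.

(** * Inversions and length *)

Section Coxeter.
Variables (W : groupType) (S : set W).
Hypothesis hWS : coxeter_system S.

(** Associativity on the carrier type of W itself: rewriting with it keeps
    syntactically equal the products that occur in arithmetic goals. *)
Lemma gmulA (x y z : W) : x * (y * z) = x * y * z.
Proof. exact: mulgA. Qed.

Lemma simple_sq s : S s -> s * s = 1.
Proof.
move=> Ss; case: hWS => m [hm hr _ _].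
by have := hr s s Ss Ss; rewrite (proj2 (proj1 (hm s s Ss Ss)) erefl) expg1.
Qed.

Lemma simple_inv s : S s -> s^-1 = s.
Proof. by move=> Ss; apply: mulg1_eq; exact: simple_sq. Qed.

Lemma conjg_eqLR (x r y : W) : (x^-1 * r * x == y) = (r == x * y * x^-1).
Proof.
by apply/eqP/eqP => [<-|->]; rewrite !gmulA ?mulgV ?mulVg ?mul1g ?mulgVK ?mulgK.
Qed.

Definition simple_lift (s : W) : twisted W := (s, fun t => t == s).

(** The reflections counted here are those met by the gallery of the word
    s t s t ... of length 2n. *)
Lemma simple_lift_expn s t (Ss : S s) (St : S t) n :
  (simple_lift s * simple_lift t) ^+ n =
  ((s * t) ^+ n, fun r => odd (\sum_(i < n.*2) (r == (s * t) ^+ i * s)%g)).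
Proof.
have ss := simple_sq Ss; have tt := simple_sq St.
elim: n => [|n IH].
  by rewrite !expg0 twisted_1E; congr pair; apply: funext => r; rewrite big_ord0.
rewrite expgS IH [in RHS]expgS !twisted_mulE /=; congr pair; apply: funext => r.
rewrite doubleS 2!big_ord_recl /= expg0 mul1g expg1 !oddD !oddb addbA.
rewrite conjg_eqLR (simple_inv Ss).
congr (_ (+) odd _); apply: eq_bigr => i _; congr (nat_of_bool _).
rewrite conjg_eqLR /bump /= !add1n; congr (_ == _).
have h : s * (s * t)^-1 = s * (t * s).
  by rewrite invgM simple_inv // simple_inv.
by rewrite expgS expgSr -!gmulA h.
Qed.

(** When (s t)^m = 1, the terms of index i and m + i of the sum in
    [simple_lift_expn] agree, so every reflection is met an even number of
    times. *)
Lemma simple_lift_relations (m : W -> W -> nat) :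
  coxeter_relations S m (fun s => s) -> coxeter_relations S m simple_lift.
Proof.
move=> hm s t Ss St; rewrite simple_lift_expn // hm // twisted_1E; congr pair.
apply: funext => r; rewrite -addnn big_split_ord /=.
set a := \sum_(i < _) _; set b := \sum_(i < _) _.
suff -> : b = a by rewrite oddD addbb.
by apply: eq_bigr => i _; rewrite expgnDr hm // mul1g.
Qed.

Lemma simple_lift_extends : exists phi : {multiplicative W -> twisted W},
  forall s, S s -> phi s = simple_lift s.
Proof. by case: hWS => m [_ hr _ univ]; apply/univ/simple_lift_relations. Qed.

(** For a word x = s_1 ... s_k, this tells whether t occurs an odd number of times
    among the reflections s_1 ... s_i ... s_1. *)
Definition inversion : W -> W -> bool :=
  fun x => (sval (cid simple_lift_extends) x).2.

Let phi := sval (cid simple_lift_extends).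

Lemma word_exists (w : W) : exists r : seq W,
  {in r, forall s, S s} /\ \prod_(s <- r) s = w.
Proof. by case: hWS => m [_ _ h _]; have [k [r [_ h1 h2]]] := h w; exists r. Qed.

Lemma phi_1 : phi 1 = 1.
Proof. by apply: (mulgI (phi 1)); rewrite -gmulfM !mulg1. Qed.

Lemma phi_fst x : (phi x).1 = x.
Proof.
have [r [hr <-]] := word_exists x; elim: r hr => [|s r IH] hr.
  by rewrite big_nil phi_1.
rewrite big_cons gmulfM /= IH => [|t tr]; last by apply: hr; rewrite inE tr orbT.
by rewrite (svalP (cid simple_lift_extends)) //; apply: hr; rewrite inE eqxx.
Qed.

Lemma inversionM x y t :
  inversion (x * y) t = inversion x t (+) inversion y (x^-1 * t * x).
Proof. by rewrite /inversion gmulfM twisted_mulE /= -/phi phi_fst. Qed.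

Lemma inversion_simple s t : S s -> inversion s t = (t == s).
Proof. by move=> Ss; rewrite /inversion (svalP (cid simple_lift_extends)). Qed.

Lemma inversion1 t : inversion 1 t = false.
Proof. by rewrite /inversion -/phi phi_1. Qed.

Lemma inversionV x t : inversion x^-1 (x^-1 * t * x) = inversion x t.
Proof.
have := inversionM x x^-1 t; rewrite mulgV inversion1.
by case: (inversion x t); case: (inversion _ _).
Qed.

(** The cocycle rule for a conjugate, with the inversions of x^-1 brought back to
    those of x. *)
Lemma inversion_conj x y t :
  inversion (x * y * x^-1) t =
  inversion x t (+) inversion y (x^-1 * t * x)
    (+) inversion x (x * y^-1 * x^-1 * t * (x * y * x^-1)).
Proof.
rewrite 2!inversionM; congr (_ (+) _).
rewrite -[RHS]inversionV; congr inversion.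
by rewrite !invgM !gmulA mulgVK mulVg mul1g.
Qed.

Lemma reflection_sq t : reflections S t -> t * t = 1.
Proof.
case=> w [s [Ss ->]]; rewrite !gmulA mulgVK -(gmulA w) simple_sq // mulg1.
exact: mulgV.
Qed.

Lemma reflection_inv t : reflections S t -> t^-1 = t.
Proof. by move=> /reflection_sq/mulg1_eq. Qed.

Lemma simple_reflection s : S s -> reflections S s.
Proof. by move=> Ss; exists 1, s; rewrite invg1 mul1g mulg1. Qed.

Lemma reflection_conj x t : reflections S t -> reflections S (x * t * x^-1).
Proof.
by case=> w [s [Ss ->]]; exists (x * w), s; rewrite invgM !gmulA.
Qed.

Lemma inversion_self t : reflections S t -> inversion t t.
Proof.
case=> w [s [Ss ->]]; rewrite inversion_conj.
have -> : w^-1 * (w * s * w^-1) * w = s by rewrite !gmulA mulVg mul1g mulgVK.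
have -> : w * s^-1 * w^-1 * (w * s * w^-1) * (w * s * w^-1) = w * s * w^-1.
  by rewrite !gmulA !mulgVK.
by rewrite (inversion_simple _ Ss) eqxx addbT addNb addbb.
Qed.

Lemma reflection_neq1 t : reflections S t -> t != 1.
Proof.
by move=> ht; apply/eqP => e; have := inversion_self ht; rewrite e inversion1.
Qed.

Local Notation len := (coxeter_length S).

Lemma len_spec w :
  has_expression S w (len w) /\ forall j, has_expression S w j -> (len w <= j)%N.
Proof.
have [r [hr pr]] := word_exists w.
have ex : exists k, `[< has_expression S w k >].
  by exists (size r); apply/asboolP; exists r.
case: (ex_minnP ex) => k /asboolP hk kmin.
set P := [set k | has_expression S w k /\
  forall j, has_expression S w j -> (k <= j)%N]%classic.
have exP : exists k, P k.
  by exists k; split=> // j hj; apply/kmin/asboolP.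
exact: (xgetPex 0%N exP).
Qed.

Lemma len_word w : exists r : seq W,
  [/\ size r = len w, {in r, forall s, S s} & \prod_(s <- r) s = w].
Proof. exact: proj1 (len_spec w). Qed.

Lemma len_le (r : seq W) : {in r, forall s, S s} ->
  (len (\prod_(s <- r) s) <= size r)%N.
Proof. by move=> hr; apply: (proj2 (len_spec _)); exists r. Qed.

Lemma len_simple s w : S s -> (len (s * w) <= (len w).+1)%N.
Proof.
move=> Ss; have [r [<- hr <-]] := len_word w.
rewrite -(big_cons _ _ s r xpredT id) -[(size r).+1]/(size (s :: r)).
by apply: len_le => t; rewrite inE => /predU1P[->|/hr].
Qed.

Lemma lenV w : len w^-1 = len w.
Proof.
suff le x : (len x^-1 <= len x)%N.
  by apply/eqP; rewrite eqn_leq le -{1}[w]invgK le.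
have [r [<- hr <-]] := len_word x.
have -> : (\prod_(s <- r) s)^-1 = \prod_(s <- rev r) s.
  rewrite -{1}(revK r) -prodgV; apply: eq_big_seq => s; rewrite mem_rev => /hr.
  exact: simple_inv.
by rewrite -size_rev; apply: len_le => s; rewrite mem_rev => /hr.
Qed.

(** The strong exchange condition: an inversion of a word is some
    s_1 ... s_i ... s_1, and multiplying by it deletes the letter s_i. *)
Lemma word_exchange (r : seq W) t : {in r, forall s, S s} ->
  inversion (\prod_(s <- r) s) t ->
  exists r' : seq W, [/\ (size r').+1 = size r, {in r', forall s, S s}
    & \prod_(s <- r') s = t * \prod_(s <- r) s].
Proof.
elim: r t => [|s r IH] t hr; first by rewrite big_nil inversion1.
have Ss : S s by apply: hr; rewrite inE eqxx.
have hr' : {in r, forall s, S s} by move=> u ur; apply: hr; rewrite inE ur orbT.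
rewrite big_cons inversionM inversion_simple //.
case: eqP => [-> _|_ /=].
  by exists r; split => //; rewrite gmulA simple_sq // mul1g.
case/(IH _ hr') => r' [sz hr'' e]; exists (s :: r'); split=> /=.
- by rewrite sz.
- by move=> u; rewrite inE => /predU1P[->|/hr''].
- by rewrite big_cons e !gmulA mulgV mul1g.
Qed.

Lemma inversion_lt x t : inversion x t -> (len (t * x) < len x)%N.
Proof.
have [r [sz hr e]] := len_word x; rewrite -[in X in X -> _]e.
case/(word_exchange hr) => r' [sz' hr' e'].
by rewrite -e -e' e -sz -sz' ltnS len_le.
Qed.

(** For a reflection t, exactly one of x and t x has t as an inversion, so that the
    implication of [inversion_lt] can be reversed. *)
Lemma inversionE x t : reflections S t -> inversion x t = (len (t * x) < len x)%N.
Proof.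
move=> ht; apply/idP/idP => [/inversion_lt//|lt]; apply/negPn/negP => nx.
have : inversion (t * x) t.
  by rewrite inversionM inversion_self // mulVg mul1g (negPf nx).
move/inversion_lt; rewrite gmulA reflection_sq // mul1g; lia.
Qed.

Lemma inversion_mull x t : reflections S t -> inversion (t * x) t = ~~ inversion x t.
Proof. by move=> ht; rewrite inversionM inversion_self // mulVg mul1g. Qed.

Lemma len_up x t : reflections S t -> ~~ inversion x t -> (len x < len (t * x))%N.
Proof.
move=> ht; rewrite -inversion_mull // => /inversion_lt.
by rewrite gmulA reflection_sq // mul1g.
Qed.

Lemma inversion_mul_simple x s u : S s ->
  inversion (x * s) u = inversion x u (+) (u == x * s * x^-1).
Proof. by move=> Ss; rewrite inversionM (inversion_simple _ Ss) conjg_eqLR. Qed.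

Lemma left_descent w : (0 < len w)%N -> exists2 s, S s & (len (s * w) < len w)%N.
Proof.
have [[|s r] [sz hr e]] := len_word w; first by rewrite -sz.
have Ss : S s by apply: hr; rewrite inE eqxx.
move=> _; exists s => //; rewrite -sz -e big_cons gmulA simple_sq // mul1g ltnS.
by apply: len_le => u ur; apply: hr; rewrite inE ur orbT.
Qed.

(** * Saturated chains *)

Definition cover (u v : W) : bool :=
  `[< exists2 t, reflections S t & v = u * t >] && (len v == (len u).+1).

Lemma coverP u v :
  reflect (exists2 t, reflections S t & v = u * t /\ len v = (len u).+1) (cover u v).
Proof.
apply: (iffP andP) => [[/asboolP[t ht e] /eqP l]|[t ht [e l]]]; first by exists t.
by split; [apply/asboolP; exists t | apply/eqP].
Qed.

Lemma cover_simple s u : S s -> (len u < len (s * u))%N -> cover u (s * u).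
Proof.
move=> Ss lt; apply/coverP; exists (u^-1 * s * u).
  rewrite -{2}[u]invgK; apply: reflection_conj; exact: simple_reflection.
split; first by rewrite !gmulA mulgV mul1g.
by have := len_simple u Ss; lia.
Qed.

(** Passing to inverses, multiplication by s changes the inversions of u^-1 only
    at the reflection u^-1 s u, which differs from t. *)
Lemma reflection_mul_simple s u t : S s -> reflections S t -> s * u != u * t ->
  (len u < len (u * t))%N -> (len (s * u) < len (s * u * t))%N.
Proof.
move=> Ss ht ne lt.
rewrite -lenV -[X in (_ < X)%N]lenV !invgM (reflection_inv ht); apply: len_up => //.
rewrite (simple_inv Ss) inversion_mul_simple // invgK.
rewrite inversionE // -{1}(reflection_inv ht) -invgM !lenV ltnNge (ltnW lt) /=.
by apply: contra ne => /eqP->; rewrite !gmulA mulgV mul1g.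
Qed.

(** A form of the lifting property.  Multiplying by s keeps the covers of a chain as
    long as s goes up along it.  If s stops going up between c and d, then
    d = s c, and the rest of the original chain continues from there. *)
Lemma chain_mul_simple s p u : S s -> path cover u p -> (len u < len (s * u))%N ->
  exists2 q, path cover (s * u) q &
    last (s * u) q = if (len (last u p) < len (s * last u p))%N
                     then s * last u p else last u p.
Proof.
move=> Ss; elim: p u => [|v p IH] u /=; first by move=> _ ->; exists [::].
case/andP=> uv vp up; have [e|ne] := eqVneq (s * u) v.
  case: ifP => h; last by exists p; rewrite e.
  exists (rcons p (s * last v p)); rewrite e ?last_rcons //.
  by rewrite rcons_path vp cover_simple.
have [t ht [ev lv]] := coverP _ _ uv; rewrite ev in ne lv *.
have lt := reflection_mul_simple Ss ht ne.
have {}lt : (len (s * u) < len (s * u * t))%N by apply: lt; rewrite lv.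
have l1 := len_simple (u * t) Ss; rewrite gmulA in l1.
have [|q hq eq] := IH v vp.
  by rewrite ev gmulA; lia.
exists (s * v :: q); last by rewrite /= eq ev.
rewrite /= hq andbT.
apply/coverP; exists t => //; rewrite ev gmulA; split=> //; lia.
Qed.

Definition saturated (u v : W) := exists2 p, path cover u p & last u p = v.

Lemma saturated_trans v u w : saturated u v -> saturated v w -> saturated u w.
Proof.
move=> [p up <-] [q vq <-]; exists (p ++ q); last by rewrite last_cat.
by rewrite cat_path up.
Qed.

Lemma cover_saturated u v : cover u v -> saturated u v.
Proof. by move=> h; exists [:: v]; rewrite //= h. Qed.

(** Choose s with s b < b, where b = a t, and use induction on the length for the pair
    s a, s b.  If s goes up from a, the chain is a, s a, ..., s b, b; otherwise a
    chain from s a to s b is multiplied by s. *)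
Lemma reflection_chain a t : reflections S t -> (len a < len (a * t))%N ->
  saturated a (a * t).
Proof.
move=> ht; have [n] := ubnP (len (a * t)).
elim: n a => // n IH a ltn lt.
have [e|ne] := eqVneq (len (a * t)) (len a).+1.
  by apply: cover_saturated; apply/coverP; exists t.
have [s Ss ds] := left_descent (leq_ltn_trans (leq0n _) lt).
have nsa : s * a != a * t.
  by apply/eqP => e; have := len_simple a Ss; rewrite e; lia.
have lt' := reflection_mul_simple Ss ht nsa lt.
have c : saturated (s * a) (s * a * t) by apply: IH => //; rewrite -gmulA; lia.
have ssK x : s * (s * x) = x by rewrite gmulA simple_sq // mul1g.
have eb : s * (s * a * t) = a * t by rewrite -gmulA ssK.
have [up|dn] := ltnP (len a) (len (s * a)).
  apply: saturated_trans (cover_saturated (cover_simple Ss up)) _.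
  apply: saturated_trans c _; rewrite -eb; apply: cover_saturated.
  by apply: cover_simple; rewrite // eb -gmulA.
have {dn}dn : (len (s * a) < len (s * (s * a)))%N.
  have := inversionE (s * a) (simple_reflection Ss).
  have := inversionE a (simple_reflection Ss).
  rewrite inversion_mull ?ssK; last exact: simple_reflection.
  by move=> ->; lia.
case: c => p hp ep; have [q] := chain_mul_simple Ss hp dn.
by rewrite ssK ep eb -gmulA ds => hq eq; exists q.
Qed.

Lemma bruhat_saturated_chain u v : bruhat_le S u v -> saturated u v.
Proof.
elim=> [a b [[t ht ->] lt]|a|a b c _ ab _ bc]; first exact: reflection_chain.
  by exists [::].
exact: saturated_trans ab bc.
Qed.

(** * Canonical generators of a dihedral reflection subgroup *)

Section Dihedral.
Variables t t' : W.
Hypotheses (ht : reflections S t) (ht' : reflections S t') (tNt' : t != t').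

(* The rotation h is kept abstract, so that rewriting does not unfold its
   powers. *)
Variable h : W.
Hypothesis hE : h = t * t'.

Definition rotation (g : W) : Prop := exists i j, g = h ^+ i / h ^+ j.

Lemma rotation_gen : rotation h.
Proof. by exists 1%N, 0%N; rewrite expg1 expg0 invg1 mulg1. Qed.

Lemma rotation1 : rotation 1.
Proof. by exists 0%N, 0%N; rewrite expg0 invg1 mulg1. Qed.

Lemma expg_comm i j : commute (h ^+ i) (h ^- j).
Proof. by apply/commuteV/commuteX2. Qed.

Lemma rotationM a b : rotation a -> rotation b -> rotation (a * b).
Proof.
move=> [i [j ->]] [k [l ->]]; exists (i + k)%N, (l + j)%N.
by rewrite -gmulA (gmulA (h ^- j)) -expg_comm !expgnDr invgM !gmulA.
Qed.

Lemma rotationV a : rotation a -> rotation a^-1.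
Proof. by case=> i [j ->]; exists j, i; rewrite invgF. Qed.

Lemma rotation_conj g : rotation g -> t * g * t = g^-1.
Proof.
have tt := reflection_sq ht; have tV := reflection_inv ht.
have cj x : t * x * t = x ^ t by rewrite conjgE tV gmulA.
have hh : h ^ t = h^-1.
  rewrite -cj hE invgM (reflection_inv ht) (reflection_inv ht') !gmulA.
  by rewrite tt mul1g.
case=> i [j ->]; rewrite cj conjMg conjVg !conjXg hh !expVgn invgK invgF.
by rewrite -expg_comm.
Qed.

Definition dihedral_refl (r : W) : Prop := rotation (t * r).

Lemma dihedral_refl_l : dihedral_refl t.
Proof. by rewrite /dihedral_refl reflection_sq //; apply: rotation1. Qed.

Lemma dihedral_refl_r : dihedral_refl t'.
Proof. by rewrite /dihedral_refl -hE; apply: rotation_gen. Qed.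

Lemma dihedral_refl_sq r : dihedral_refl r -> r * r = 1.
Proof.
move=> hr; have := rotation_conj hr; rewrite !gmulA reflection_sq // mul1g => e.
have : (r * t) * (t * r) = 1 by rewrite e mulVg.
by rewrite gmulA -(gmulA r) reflection_sq // mulg1.
Qed.

Lemma dihedral_refl_inv r : dihedral_refl r -> r^-1 = r.
Proof. by move=> /dihedral_refl_sq/mulg1_eq. Qed.

Lemma dihedral_refl_rotation r g :
  dihedral_refl r -> rotation g -> dihedral_refl (r * g).
Proof. by move=> hr hg; rewrite /dihedral_refl gmulA; apply: rotationM. Qed.

Lemma rotation_mul a b : dihedral_refl a -> dihedral_refl b -> rotation (a * b).
Proof.
move=> ha hb; have -> : a * b = (t * a)^-1 * (t * b).
  rewrite invgM (reflection_inv ht) (dihedral_refl_inv ha) !gmulA.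
  by rewrite -(gmulA a) reflection_sq // mulg1.
by apply: rotationM => //; apply: rotationV.
Qed.

Lemma dihedral_refl3 a b c :
  dihedral_refl a -> dihedral_refl b -> dihedral_refl c ->
  dihedral_refl (a * b * c).
Proof.
by move=> ha hb hc; rewrite -gmulA; apply/dihedral_refl_rotation/rotation_mul.
Qed.

(** Conjugation by a power of h changes the exponent of t h^i by an even
    number, which leaves the cases t, t' and t t' t. *)
Lemma dihedral_reflection r : dihedral_refl r -> reflections S r.
Proof.
case=> i [j e]; have {e} -> : r = t * (h ^+ i / h ^+ j).
  by rewrite -e gmulA reflection_sq // mul1g.
have tt := reflection_sq ht; have tV := reflection_inv ht.
have thE : t * h = h^-1 * t.
  rewrite hE invgM (reflection_inv ht) (reflection_inv ht').
  by rewrite gmulA tt mul1g -gmulA tt mulg1.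
have stepi k l : reflections S (t * (h ^+ k / h ^+ l)) ->
    reflections S (t * (h ^+ k.+2 / h ^+ l)).
  move=> /(reflection_conj h^-1); congr reflections.
  rewrite invgK expgS expgSr !gmulA thE -!gmulA; congr (_ * (_ * (_ * _))).
  exact: esym (expg_comm 1 l).
have stepj k l : reflections S (t * (h ^+ k / h ^+ l)) ->
    reflections S (t * (h ^+ k / h ^+ l.+2)).
  move=> /(reflection_conj h); congr reflections.
  have thE' : h * t = t * h^-1.
    by apply: (mulIg h); rewrite mulgVK -gmulA thE gmulA mulgV mul1g.
  rewrite gmulA thE' expgS expgSr !invgM -!gmulA; congr (_ * _); rewrite !gmulA.
  by congr (_ / _ / _); rewrite -[h^-1]/(h ^- 1) -expg_comm.
elim/ltn_ind: i => -[|[|i]] IHi; last by apply/stepi/IHi; lia.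
  elim/ltn_ind: j {IHi} => -[|[|j]] IHj; last by apply/stepj/IHj; lia.
    by rewrite expg0 invg1 !mulg1.
  rewrite expg0 expg1 mul1g hE invgM (reflection_inv ht) (reflection_inv ht').
  by rewrite gmulA -{2}tV; apply: reflection_conj.
elim/ltn_ind: j {IHi} => -[|[|j]] IHj; last by apply/stepj/IHj; lia.
  by rewrite expg0 expg1 invg1 mulg1 hE gmulA tt mul1g.
by rewrite mulgV mulg1.
Qed.

Lemma dihedral_refl_conj a b :
  dihedral_refl a -> dihedral_refl b -> dihedral_refl (a * b * a).
Proof. by move=> ha hb; apply: dihedral_refl3. Qed.

(** These are the elements of minimal length in their coset under left
    multiplication by the dihedral group. *)
Definition dihedral_min (x : W) : Prop :=
  forall r, dihedral_refl r -> ~~ inversion x r.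

(** Dyer's canonical generators of the subgroup. *)
Definition canonical_refl (r : W) : Prop :=
  dihedral_refl r /\ forall u, dihedral_refl u -> inversion r u -> u = r.

Lemma inversion_canonical r u :
  canonical_refl r -> dihedral_refl u -> inversion r u = (u == r).
Proof.
move=> [hr cr] hu; apply/idP/eqP => [/(cr _ hu)//|->].
exact/inversion_self/dihedral_reflection.
Qed.

(** Along a reduced word of x, the first letter that adds an inversion
    belonging to the dihedral group adds the reflection y s y^-1, where the prefix y
    has no such inversion; then neither has y s y^-1, besides itself. *)
Lemma canonical_inversion x u : dihedral_refl u -> inversion x u ->
  exists2 r, canonical_refl r & inversion x r.
Proof.
have [n] := ubnP (len x); elim: n x u => // n IH x u ltn hu xu.
have x0 : (0 < len x^-1)%N by rewrite lenV; have := inversion_lt xu; lia.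
have [s Ss] := left_descent x0.
rewrite -(lenV (s * _)) invgM invgK (simple_inv Ss) lenV => lt.
set y := x * s in lt; have sV := simple_inv Ss.
have ex : x = y * s by rewrite /y -gmulA simple_sq // mulg1.
have rS : reflections S (y * s * y^-1).
  by apply: reflection_conj; exact: simple_reflection.
have rx : y * s * y^-1 * y = x by rewrite mulgVK -ex.
have nyr : ~~ inversion y (y * s * y^-1) by rewrite inversionE // rx; lia.
have xr : inversion x (y * s * y^-1).
  by rewrite ex inversion_mul_simple // eqxx addbT.
have [[v hv yv]|no] := EM (exists2 v, dihedral_refl v & inversion y v).
  have [|r cr yr] := IH y v _ hv yv; first by lia.
  exists r => //; rewrite ex inversion_mul_simple // yr.
  by case: eqP => // e; rewrite -e yr in nyr.
have {}no v : dihedral_refl v -> ~~ inversion y v.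
  by move=> hv; apply/negP => yv; apply: no; exists v.
move: (xu); rewrite {1}ex inversion_mul_simple // (negPf (no _ hu)) => /eqP eu.
exists (y * s * y^-1) => //; rewrite -eu; split=> // v hv.
rewrite {1}eu inversion_conj (negPf (no _ hv)) /= sV -eu.
rewrite (negPf (no _ (dihedral_refl_conj hu hv))) addbF (inversion_simple _ Ss).
by rewrite conjg_eqLR -eu => /eqP.
Qed.

(** If p = q r q, the cocycle rule computes the value at q of the inversion
    set of p in two ways; this forces p q p = q, hence r = p. *)
Lemma canonical_conj_neq p q r :
  canonical_refl p -> canonical_refl q -> canonical_refl r ->
  p != q -> p != r -> q != r -> p != q * r * q.
Proof.
move=> cp cq cr pq pr qr; apply/eqP => e.
have [[dp _] [dq _] [dr _]] := And3 cp cq cr.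
have := inversion_canonical cp dq; rewrite eq_sym (negPf pq) {1}e.
have qK : q * q = 1 := dihedral_refl_sq dq.
rewrite -{2}(dihedral_refl_inv dq) inversion_conj.
rewrite (dihedral_refl_inv dq) (dihedral_refl_inv dr) -e qK mul1g.
rewrite (inversion_canonical cq dq) eqxx (inversion_canonical cr dq) (negPf qr).
have dpq : dihedral_refl (p * q * p) by apply: dihedral_refl_conj.
rewrite (inversion_canonical cq dpq) /= => /negbFE/eqP.
move=> h1; have h2 : p * q = q * p.
  by rewrite -[in RHS]h1 -(gmulA (p * q)) (dihedral_refl_sq dp) mulg1.
have er : r = q * p * q.
  by rewrite e !gmulA qK mul1g -gmulA qK mulg1.
by move: pr; rewrite er -h2 -gmulA qK mulg1 eqxx.
Qed.

Lemma inversion_canonical_mul p x u : canonical_refl p -> dihedral_refl u ->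
  inversion (p * x) u = (u == p) (+) inversion x (p * u * p).
Proof.
move=> cp hu; rewrite inversionM (inversion_canonical cp hu).
by rewrite (dihedral_refl_inv (proj1 cp)).
Qed.

Lemma conj_invol_eq p u v :
  dihedral_refl p -> (p * u * p == v) = (u == p * v * p).
Proof. by move=> dp; rewrite -{1 4}(dihedral_refl_inv dp) conjg_eqLR. Qed.

(** A product of three dihedral reflections is a dihedral reflection, hence
    p q r = r q p.  The inversions computed from the two sides are
    p, p q p, p q r q p and r, r q r, r q p q r.  Since p is among the former, it is
    among the latter, and [canonical_conj_neq] leaves only p = r q p q r. *)
Lemma canonical_commute p q r :
  canonical_refl p -> canonical_refl q -> canonical_refl r ->
  p != q -> p != r -> q != r -> q * r = r * q.
Proof.
move=> cp cq cr pq pr qr.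
have [[dp _] [dq _] [dr _]] := And3 cp cq cr.
have dpqr : dihedral_refl (p * q * r) by apply: dihedral_refl3.
have e : p * q * r = r * q * p.
  rewrite -{1}(dihedral_refl_inv dpqr) !invgM gmulA.
  by rewrite (dihedral_refl_inv dp) (dihedral_refl_inv dq) (dihedral_refl_inv dr).
have : inversion (p * q * r) p.
  rewrite -gmulA inversion_canonical_mul // eqxx (dihedral_refl_sq dp) mul1g.
  rewrite inversion_canonical_mul // (negPf pq) (inversion_canonical cr);
    last exact: dihedral_refl_conj.
  by rewrite conj_invol_eq // (negPf (canonical_conj_neq _ _ _ _ _ _)).
rewrite e -gmulA inversion_canonical_mul // (negPf pr).
rewrite inversion_canonical_mul //; last exact: dihedral_refl_conj.
rewrite conj_invol_eq // (negPf (canonical_conj_neq cp cr cq pr pq _)) 1?eq_sym //=.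
rewrite (inversion_canonical cp); last by do 2 apply: dihedral_refl_conj => //.
rewrite !conj_invol_eq // => /eqP e2.
have e3 : p * r * q = r * q * p.
  rewrite {1}e2 !gmulA.
  rewrite -(gmulA _ r r) (dihedral_refl_sq dr) mulg1.
  by rewrite -(gmulA _ q q) (dihedral_refl_sq dq) mulg1.
by apply: (mulgI p); rewrite !gmulA e -e3.
Qed.

(** Three distinct canonical generators would commute pairwise, so the
    inversions of the reflection p q r would be p, q and r.  As p q r is an
    inversion of itself, it would be one of them, and two of the three would be
    equal. *)
Lemma canonical_at_most_two p q r :
  canonical_refl p -> canonical_refl q -> canonical_refl r ->
  p != q -> r = p \/ r = q.
Proof.
move=> cp cq cr pq; have [->|rp] := eqVneq r p; first by left.
have [->|rq] := eqVneq r q; [by right | exfalso].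
have [[dp _] [dq _] [dr _]] := And3 cp cq cr.
have c1 : q * r = r * q by apply: (canonical_commute cp); rewrite // eq_sym.
have c2 : p * r = r * p.
  by apply: (canonical_commute cq); rewrite // eq_sym.
have c3 : p * q = q * p by apply: (canonical_commute cr).
have dpqr : dihedral_refl (p * q * r) by apply: dihedral_refl3.
have := inversion_self (dihedral_reflection dpqr).
rewrite -{1}gmulA inversion_canonical_mul // inversion_canonical_mul //;
  last exact: dihedral_refl_conj.
rewrite (inversion_canonical cr); last by do 2 apply: dihedral_refl_conj => //.
have [pp qq] := (dihedral_refl_sq dp, dihedral_refl_sq dq).
rewrite !conj_invol_eq //.
have -> : p * q * p = q by rewrite c3 -gmulA pp mulg1.
have -> : p * (q * r * q) * p = r by rewrite c1 -(gmulA r) qq mulg1 c2 -gmulA pp mulg1.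
have -> : (p * q * r == p) = false.
  rewrite -gmulA -{2}[p]mulg1 (inj_eq (mulgI p)) mulg_eq1 (dihedral_refl_inv dr).
  by rewrite eq_sym (negPf rq).
have -> : (p * q * r == q) = false.
  rewrite c3 -gmulA -{2}[q]mulg1 (inj_eq (mulgI q)) mulg_eq1.
  by rewrite (dihedral_refl_inv dr) eq_sym (negPf rp).
by rewrite -{2}[r]mul1g (inj_eq (mulIg r)) mulg_eq1 (dihedral_refl_inv dq) (negPf pq).
Qed.

(** Every element descends to a minimal one of its coset through canonical
    generators, by [canonical_inversion]. *)
Lemma canonical_ind (P : W -> Prop) :
  (forall x, dihedral_min x -> P x) ->
  (forall r x, canonical_refl r -> P x -> P (r * x)) -> forall x, P x.
Proof.
move=> P0 Pr x; have [n] := ubnP (len x); elim: n x => // n IH x ltn.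
have [[u hu xu]|no] := EM (exists2 u, dihedral_refl u & inversion x u); last first.
  by apply: P0 => u hu; apply/negP => xu; apply: no; exists u.
have [r cr xr] := canonical_inversion hu xu; have lt := inversion_lt xr.
have := Pr r (r * x) cr; rewrite gmulA (dihedral_refl_sq (proj1 cr)) mul1g; apply.
by apply: IH; lia.
Qed.

(** Descend from r to an element g of the dihedral group without inversions in it.
    It is a rotation, as a reflection is an inversion of itself.  For a
    canonical generator p the reflection p g then has the inversions of p only,
    so p g = p and g = 1. *)
Lemma dihedral_refl_generated (P : W -> Prop) : P 1 ->
  (forall r x, canonical_refl r -> P x -> P (r * x)) ->
  forall r, dihedral_refl r -> P r.
Proof.
move=> P1 Pr r hr.
have [p cp _] := canonical_inversion dihedral_refl_l (inversion_self ht).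
suff H x : dihedral_refl x \/ rotation x -> P x by apply: H; left.
move: x; apply: canonical_ind => [x hx|q x cq IH] dx.
  case: dx => [dx|rx].
    by have := hx _ dx; rewrite inversion_self //; apply: dihedral_reflection.
  have dpx := dihedral_refl_rotation (proj1 cp) rx.
  have := inversion_self (dihedral_reflection dpx); rewrite inversion_canonical_mul //.
  rewrite (negPf (hx _ _)) ?addbF; last by apply: dihedral_refl_conj => //; case: cp.
  by rewrite -{2}[p]mulg1 (inj_eq (mulgI p)) => /eqP->.
apply: Pr => //; apply: IH.
have dq := proj1 cq; have qK : q * (q * x) = x.
  by rewrite gmulA dihedral_refl_sq // mul1g.
case: dx => [dx|rx]; first by right; rewrite -qK; apply: rotation_mul.
by left; rewrite -qK; apply: dihedral_refl_rotation.
Qed.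

Definition canonical_gens (p q : W) : Prop :=
  [/\ canonical_refl p, canonical_refl q, p != q
    & forall r, canonical_refl r -> r = p \/ r = q].

(** With a single canonical generator p, every dihedral reflection would be a
    power of p, in particular t = t'. *)
Lemma canonical_gens_exist : exists p q, canonical_gens p q.
Proof.
have [p cp _] := canonical_inversion dihedral_refl_l (inversion_self ht).
have [[q [cq pq]]|no] := EM (exists q, canonical_refl q /\ p != q).
  by exists p, q; split=> // r cr; apply: canonical_at_most_two.
have only_p r : dihedral_refl r -> r = p.
  move=> dr; have [] : r = 1 \/ r = p; last by [].
    move: r dr; apply: dihedral_refl_generated; first by left.
    move=> r x cr; have -> : r = p.
      by apply/eqP/negPn/negP => nr; apply: no; exists r; rewrite eq_sym.
    case=> ->; first by right; rewrite mulg1.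
    by left; rewrite (dihedral_refl_sq (proj1 cp)).
  by move=> e; have := reflection_neq1 (dihedral_reflection dr); rewrite e eqxx.
by move: tNt'; rewrite (only_p _ dihedral_refl_l) (only_p _ dihedral_refl_r) eqxx.
Qed.

(** * Levels of a coset of the dihedral subgroup *)

Fixpoint alt_word (p q : W) (k : nat) : W :=
  if k is k'.+1 then p * alt_word q p k' else 1.

Definition alt_refl (p q : W) (i : nat) : W := (p * q) ^+ i * p.

(** This holds for all k when p q has infinite order, and otherwise for the k up to
    its order.  It says that the first k reflections [alt_refl] are distinct. *)
Definition distinct_upto (p q : W) (k : nat) : Prop :=
  forall i, (0 < i < k)%N -> (p * q) ^+ i != 1.

Lemma swap_expn (p q : W) i : p * (q * p) ^+ i = (p * q) ^+ i * p.
Proof.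
elim: i => [|i IH]; first by rewrite !expg0 mulg1 mul1g.
by rewrite expgS !gmulA -gmulA IH gmulA -expgS.
Qed.

Lemma canonical_gensC p q : canonical_gens p q -> canonical_gens q p.
Proof. by case=> cp cq pq H; split; rewrite // 1?eq_sym // => r /H[]; auto. Qed.

Section Levels.
Variables p q : W.
Hypothesis cpq : canonical_gens p q.

Let dp : dihedral_refl p. Proof. by case: cpq => -[]. Qed.
Let dq : dihedral_refl q. Proof. by case: cpq => _ []. Qed.

Lemma alt_swap k : alt_word p q k = (p * q) ^+ k * alt_word q p k.
Proof.
have gen k' : alt_word p q k' = (p * q) ^+ k' * alt_word q p k' /\
    alt_word q p k' = (q * p) ^+ k' * alt_word p q k'.
  elim: k' => [|k' [IH1 IH2]] /=; first by rewrite !expg0 !mulg1.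
  split.
    rewrite {1}IH2 gmulA swap_expn expgSr -!gmulA (gmulA q q).
    by rewrite (dihedral_refl_sq dq) mul1g.
  rewrite {1}IH1 gmulA swap_expn expgSr -!gmulA (gmulA p p).
  by rewrite (dihedral_refl_sq dp) mul1g.
by case: (gen k).
Qed.

Lemma expg_swap i : (q * p) ^+ i = (p * q) ^- i.
Proof. by rewrite -expVgn invgM (dihedral_refl_inv dp) (dihedral_refl_inv dq). Qed.

Lemma alt_refl_alt k : alt_refl p q k * alt_word p q k = alt_word p q k.+1.
Proof.
by rewrite alt_swap /alt_refl -swap_expn !gmulA -(gmulA p) expg_swap mulVg mulg1.
Qed.

Lemma dihedral_alt_refl i : dihedral_refl (alt_refl p q i).
Proof.
rewrite /alt_refl -swap_expn; apply: dihedral_refl_rotation => //.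
elim: i => [|i IH]; first exact: rotation1.
by rewrite expgS; apply: rotationM => //; apply: rotation_mul.
Qed.

Lemma alt_reflS i : p * alt_refl q p i * p = alt_refl p q i.+1.
Proof. by rewrite /alt_refl gmulA swap_expn expgSr -!gmulA. Qed.

Lemma alt_refl_inj k i j : distinct_upto p q k -> (i < k)%N -> (j < k)%N ->
  alt_refl p q i = alt_refl p q j -> i = j.
Proof.
wlog lt : i j / (i < j)%N => [H|] hk ik jk e.
  by case: (ltngtP i j) => // ij; [apply: H | apply/esym/H].
have /eqP[] : (p * q) ^+ (j - i) != 1 by apply: hk; lia.
by rewrite expgnFr ?(ltnW lt) // -(mulIg _ _ _ e) mulgV.
Qed.

Lemma distinct_uptoC k : distinct_upto p q k -> distinct_upto q p k.
Proof. by move=> hk i ik; rewrite expg_swap invg_eq1 hk. Qed.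

Lemma distinct_upto_leq j k : (j <= k)%N -> distinct_upto p q k -> distinct_upto p q j.
Proof. by move=> jk hk i ij; apply: hk; lia. Qed.

Lemma alt_refl_neq k i : distinct_upto p q k -> (i.+1 < k)%N -> alt_refl p q i != q.
Proof.
move=> hk ik; apply/eqP => e; have := hk i.+1 ik.
by rewrite expgSr gmulA -/(alt_refl p q i) e (dihedral_refl_sq dq) eqxx.
Qed.

End Levels.

Definition has_alt_refl (p q : W) (k : nat) (u : W) : bool :=
  has (fun i => u == alt_refl p q i) (iota 0 k).

Lemma has_alt_reflP p q k u :
  reflect (exists2 i, (i < k)%N & u = alt_refl p q i) (has_alt_refl p q k u).
Proof.
apply: (iffP hasP) => [[i ik /eqP->]|[i ik ->]]; exists i => //.
  by move: ik; rewrite mem_iota.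
by rewrite mem_iota.
Qed.

(** The inversions of y contribute nothing, and the prefixes of the alternating
    word contribute p, p q p, p q p q p, ...; being distinct, these do not
    cancel. *)
Lemma inversion_alt p q y k u : canonical_gens p q -> dihedral_min y ->
  distinct_upto p q k -> dihedral_refl u ->
  inversion (alt_word p q k * y) u = has_alt_refl p q k u.
Proof.
move=> cpq hy; elim: k p q cpq u => [|k IH] p q cpq u hk hu.
  by rewrite mul1g (negPf (hy _ hu)).
have [cp cq _ _] := cpq; have [dp _] := cp.
have hk' : distinct_upto q p k.
  by apply: distinct_uptoC => //; apply: distinct_upto_leq hk.
rewrite /= -gmulA inversion_canonical_mul //.
rewrite (IH q p (canonical_gensC cpq) _ hk' (dihedral_refl_conj dp hu)).
have -> : has_alt_refl q p k (p * u * p) =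
    has (fun i => u == alt_refl p q i.+1) (iota 0 k).
  by apply: eq_has => i; rewrite conj_invol_eq // alt_reflS.
rewrite /has_alt_refl /= (iotaDl 1 0) has_map.
have -> : alt_refl p q 0 = p by rewrite /alt_refl expg0 mul1g.
case: eqP => //= -> ; apply/hasPn => i; rewrite mem_iota /= => ik.
apply/eqP => e; have e0 : alt_refl p q 0 = alt_refl p q i.+1.
  by rewrite -e /alt_refl expg0 mul1g.
by have := alt_refl_inj hk (ltn0Sn k) (ik : (i.+1 < k.+1)%N) e0.
Qed.

(** The elements of the coset of y that have exactly k inversions in the
    dihedral group, when y is minimal; up to the top level of a finite
    dihedral group. *)
Definition level (p q y : W) (k : nat) (z : W) : Prop :=
  distinct_upto p q k /\ (z = alt_word p q k * y \/ z = alt_word q p k * y).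

Lemma levelC p q y k z : canonical_gens p q -> level p q y k z -> level q p y k z.
Proof.
by move=> cpq [hk hz]; split; [apply: distinct_uptoC | case: hz; auto].
Qed.

(** Multiplying by p moves one level up or down.  At the top level of a finite
    dihedral group, the two alternating words agree by [alt_swap], so that p
    leads down from both. *)
Lemma level_mul p q y z : canonical_gens p q ->
  (exists k, level p q y k z) -> exists k, level p q y k (p * z).
Proof.
move=> cpq; have [[dp _] [dq _] _ _] := cpq.
have qpK k : p * alt_word p q k.+1 = alt_word q p k.
  by rewrite /= gmulA dihedral_refl_sq // mul1g.
case=> k [hk hz]; case: k hk hz => [|k] hk hz.
  exists 1%N; split; first by move=> i; lia.
  by left; case: hz => ->; rewrite /= mul1g mulg1.
case: hz => ->.
  exists k; split; first by apply: distinct_upto_leq hk.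
  by right; rewrite gmulA qpK.
have [e|ne] := eqVneq ((p * q) ^+ k.+1) 1.
  exists k; split; first by apply: distinct_upto_leq hk.
  right; rewrite gmulA; congr (_ * _).
  by have := alt_swap cpq k.+1; rewrite e mul1g => <-; rewrite qpK.
exists k.+2; split; last by left; rewrite gmulA.
by move=> i ik; have [->//|ni] := eqVneq i k.+1; apply: hk; lia.
Qed.

Lemma level_exists p q x : canonical_gens p q ->
  exists2 y, dihedral_min y & exists k, level p q y k x.
Proof.
move=> cpq; move: x; apply: canonical_ind => [x hx|r x cr [y hy hx]].
  by exists x => //; exists 0%N; split; [move=> i; lia | left; rewrite mul1g].
exists y => //; case: cpq (cpq) => _ _ _ /(_ r cr)[] -> cpq; first exact: level_mul.
have [k hk] : exists k, level q p y k (q * x).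
  apply: level_mul; first exact: canonical_gensC.
  by case: hx => k /levelC hk; exists k; apply: hk.
by exists k; apply: levelC => //; apply: canonical_gensC.
Qed.

Lemma level_mul_refl p q y z r : canonical_gens p q -> dihedral_refl r ->
  (exists k, level p q y k z) -> exists k, level p q y k (r * z).
Proof.
move=> cpq hr hz; move: r hr; apply: dihedral_refl_generated; first by rewrite mul1g.
move=> r x cr hx; rewrite -gmulA; case: cpq (cpq) => _ _ _ /(_ r cr)[] -> cpq.
  exact: level_mul.
have [k hk] : exists k, level q p y k (q * (x * z)).
  apply: level_mul; first exact: canonical_gensC.
  by case: hx => k /levelC hk; exists k; apply: hk.
by exists k; apply: levelC => //; apply: canonical_gensC.
Qed.

(** Any two elements of successive levels differ by a reflection, which is not an
    inversion of the lower one: [alt_refl] of index k when their words start with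
    the same letter, and the first letter of the longer word otherwise. *)
Lemma len_levelS p q y k z z' : canonical_gens p q -> dihedral_min y ->
  level p q y k z -> level p q y k.+1 z' -> (len z < len z')%N.
Proof.
move=> cpq hy; wlog -> : p q cpq / z = alt_word p q k * y => [H|] [hk hz] [hk' hz'].
  case: (hz) => ez; first by apply: (H p q); rewrite /level; auto.
  apply: (H q p) => //; first exact: canonical_gensC.
    by apply: levelC.
  by apply: levelC.
have [[dp _] [dq _] _ _] := cpq.
have [->|->] : z' = alt_refl p q k * (alt_word p q k * y) \/
    z' = q * (alt_word p q k * y).
- by case: hz' => ->; [left; rewrite gmulA alt_refl_alt | right; rewrite gmulA].
- have dk := dihedral_alt_refl cpq k.
  apply: len_up; first exact: dihedral_reflection.
  rewrite inversion_alt //; apply/has_alt_reflP => -[i ik e].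
  by have := alt_refl_inj hk' (ltnSn k) (ltnW ik) e; lia.
- apply: len_up; first exact: dihedral_reflection.
  rewrite inversion_alt //; apply/has_alt_reflP => -[i ik e].
  by have := @alt_refl_neq p q cpq k.+1 i hk' ik; rewrite -e eqxx.
Qed.

Lemma len_level p q y j k z z' : canonical_gens p q -> dihedral_min y ->
  level p q y j z -> level p q y k z' -> (j < k)%N -> (len z + (k - j) <= len z')%N.
Proof.
move=> cpq hy hz; elim: k z' => // k IH z' hz' jk.
have [e|ne] := eqVneq j k.
  by move: hz' ; rewrite -e => hz'; have := len_levelS cpq hy hz hz'; lia.
have hk : level p q y k (alt_word p q k * y).
  by split; [apply: distinct_upto_leq (proj1 hz') => // | left].
have := IH _ hk; have := len_levelS cpq hy hk hz'; lia.
Qed.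

(** Lengths increase by at least the difference of levels, which leaves only
    the case of two elements on the same level.  There the reflection r would be
    the rotation (q p)^j as well as one of the inversions (q p)^i q of its product
    with z, and a conjugate of p or q would be trivial. *)
Lemma level_cover p q y j k z r :
  canonical_gens p q -> dihedral_min y -> dihedral_refl r ->
  level p q y j z -> level p q y k (r * z) -> len (r * z) = (len z).+1 -> k = j.+1.
Proof.
move=> cpq hy hr hz hrz e.
have [lt|lt|ejk] := ltngtP j k; last 1 first.
- exfalso; move: e; rewrite -ejk in hrz * => e {ejk k}.
  have rz : r * z <> z by move=> e'; move: e; rewrite e'; lia.
  have nrz : ~~ inversion z r.
    by rewrite inversionE ?e; [lia | exact: dihedral_reflection].
  wlog ez : p q cpq hz hrz / z = alt_word p q j * y => [H|].
    case: (hz) => hj [] ez; first exact: (H p q).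
    by apply: (H q p) => //; [apply: canonical_gensC | apply: levelC | apply: levelC].
  have [hj _] := hz.
  have ez' : r * z = alt_word q p j * y.
    by case: hrz => _ [] // e'; case: rz; rewrite e' ez.
  have cqp := canonical_gensC cpq.
  have : inversion (r * z) r by rewrite inversion_mull //; apply: dihedral_reflection.
  rewrite ez' inversion_alt //; last exact: distinct_uptoC.
  case/has_alt_reflP => i ij er.
  have er2 : r = (q * p) ^+ j.
    apply: (mulIg (alt_word p q j * y)).
    by rewrite -{1}ez ez' (alt_swap cqp) gmulA.
  have : alt_refl p q (j - i).-1 = 1.
    apply: (mulgI ((q * p) ^+ i * q)); rewrite mulg1 -[RHS]/(alt_refl q p i) -er er2.
    rewrite /alt_refl -(swap_expn p q) gmulA -(gmulA _ q p) -expgSr -expgnDr.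
    by congr (_ ^+ _); lia.
  move=> e1; have dji := dihedral_alt_refl cpq (j - i).-1.
  have := reflection_neq1 (dihedral_reflection dji).
  by rewrite e1 eqxx.
- by have := len_level cpq hy hz hrz lt; lia.
- by have := len_level cpq hy hrz hz lt; lia.
Qed.

(** The inversions of x form an initial segment of one of the two alternating
    sequences; as p is an inversion and q is not, it is the sequence that starts
    with p.  Distinctness up to k + 2 ensures that the reflection of index k + 1
    does not come earlier in the sequence under another index. *)
Lemma alt_inversion_closed p q k x : canonical_gens p q -> distinct_upto p q k.+2 ->
  inversion x p -> ~~ inversion x q ->
  inversion x (alt_refl p q k.+1) -> inversion x (alt_refl p q k).
Proof.
move=> cpq hk xp nxq.
have [y hy [m [hm ex]]] := level_exists x cpq.
have [[dp _] [dq _] _ _] := cpq; have cqp := canonical_gensC cpq.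
have hqm := distinct_uptoC cpq hm.
have dk i := dihedral_alt_refl cpq i.
case: ex xp nxq => ->; last first.
  rewrite !inversion_alt //; case: m {hm} hqm => [|m] hm.
    by move=> /has_alt_reflP[].
  by move=> _ /has_alt_reflP[]; exists 0%N; rewrite // /alt_refl expg0 mul1g.
move=> _ _.
rewrite !inversion_alt // => /has_alt_reflP[i im e]; apply/has_alt_reflP.
have [lt|ge] := ltnP k m; first by exists k.
by have := alt_refl_inj hk (ltnSn _) (leq_trans im (leqW (leqW ge))) e; lia.
Qed.

(** The elements y, t y and t' t y lie on levels k, k + 1 and k + 2, and r y is the
    other element of level k + 1.  If the words of y and t' t y start with
    different letters, q labels the lower edge of one path and the upper edge
    of the other, so one of the two is not a peak.  If they start with the same
    letter p, the labels are q, p on one path and the reflections of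
    indices k, k + 1 on the other; [alt_inversion_closed] forbids two peaks. *)
Lemma dihedral_diamond x y :
  len (t * y) = (len y).+1 -> len (t' * (t * y)) = (len (t * y)).+1 ->
  ~~ inversion x t -> inversion x t' ->
  exists r r', [/\ reflections S r, reflections S r', r' * (r * y) = t' * (t * y),
    len (r * y) = (len y).+1 & inversion x r || ~~ inversion x r'].
Proof.
move=> l1 l2 nxt xt'.
have [p0 [q0 cpq0]] := canonical_gens_exist.
have [y0 hy0 [k hk0]] := level_exists y cpq0.
have [p [q [cpq hk ey]]] : exists p q, [/\ canonical_gens p q, level p q y0 k y
    & y = alt_word p q k * y0].
  case: (hk0) => hk [] ey; first by exists p0, q0.
  by exists q0, p0; split; [apply: canonical_gensC | apply: levelC |].
have cqp := canonical_gensC cpq; have [[dp _] [dq _] _ _] := cpq.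
have [rp rq] := (dihedral_reflection dp, dihedral_reflection dq).
have [k1 hk1] : exists k, level p q y0 k (t * y).
  by apply: level_mul_refl => //; [exact: dihedral_refl_l | exists k].
have [k2 hk2] : exists k, level p q y0 k (t' * (t * y)).
  by apply: level_mul_refl => //; [exact: dihedral_refl_r | exists k1].
have e1 := level_cover cpq hy0 dihedral_refl_l hk hk1 l1; rewrite {}e1 in hk1.
have e2 := level_cover cpq hy0 dihedral_refl_r hk1 hk2 l2; rewrite {}e2 in hk2.
have [dk2 ek2] := hk2; have dk1 : distinct_upto p q k.+1 := proj1 hk1.
have mid z : level p q y0 k.+1 z -> len z = (len y).+1.
  move=> hz; have := len_levelS cpq hy0 hk hz.
  by have := len_levelS cpq hy0 hz hk2; lia.
have dA i := dihedral_reflection (dihedral_alt_refl cpq i).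
have dB i := dihedral_reflection (dihedral_alt_refl cqp i).
have EA : alt_refl p q k * y = alt_word p q k.+1 * y0 by rewrite ey gmulA alt_refl_alt.
have EF : q * y = alt_word q p k.+1 * y0 by rewrite ey gmulA.
have lE : level p q y0 k.+1 (alt_word p q k.+1 * y0) by split=> //; left.
have lF : level p q y0 k.+1 (alt_word q p k.+1 * y0) by split=> //; right.
(* The word of y starts with p (for k = 0 it is empty); the cases are the first
   letters of the words of t y and of t' t y. *)
case: (proj2 hk1) => ec; case: ek2 => eb.
- have et : t = alt_refl p q k by apply: (mulIg y); rewrite EA.
  have et' : t' = alt_refl p q k.+1.
    by apply: (mulIg (t * y)); rewrite eb ec gmulA alt_refl_alt.
  exists q, p; split=> //; [by rewrite EF eb gmulA | by rewrite EF; apply: mid|].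
  rewrite -implyNb; apply/implyP => nq; apply: contra nxt => xp.
  by rewrite et; apply: alt_inversion_closed => //; rewrite -et'.
- have et' : t' = q by apply: (mulIg (t * y)); rewrite eb ec gmulA.
  exists q, (alt_refl q p k.+1); split=> //.
  + by rewrite EF eb gmulA alt_refl_alt.
  + by rewrite EF; apply: mid.
  + by rewrite -et' xt'.
- have et : t = q by apply: (mulIg y); rewrite EF.
  have et' : t' = p by apply: (mulIg (t * y)); rewrite eb ec gmulA.
  exists (alt_refl p q k), (alt_refl p q k.+1); split=> //.
  + by rewrite EA eb gmulA alt_refl_alt.
  + by rewrite EA; apply: mid.
  + rewrite orbC -implybE; apply/implyP; apply: alt_inversion_closed => //.
      by rewrite -et'.
    by rewrite -et.
- have et : t = q by apply: (mulIg y); rewrite EF.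
  exists (alt_refl p q k), q; split=> //.
  + by rewrite EA eb gmulA.
  + by rewrite EA; apply: mid.
  + by rewrite -et nxt orbT.
Qed.

End Dihedral.

(** * Exchanging peaks *)

Lemma inversion_mulV a t : inversion a (a * t * a^-1) = inversion a^-1 t.
Proof. by rewrite -inversionV !gmulA mulVg mul1g mulgVK. Qed.

Lemma translate_lt a x t : reflections S t ->
  (len (a * t * x) < len (a * x))%N = inversion a^-1 t (+) inversion x t.
Proof.
move=> ht; have e : a * t * x = (a * t * a^-1) * (a * x) by rewrite gmulA mulgVK.
rewrite e -inversionE; last exact: reflection_conj.
by rewrite inversionM inversion_mulV !gmulA mulVg mul1g mulgVK.
Qed.

(** By the cocycle rule, a t a^-1 is an inversion of a x when either it is one of a
    or t is one of x, but not both; going up from a to a t excludes the first. *)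
Lemma translate_up a x t : reflections S t -> (len a < len (a * t))%N ->
  ((len (a * t * x) < len (a * x))%N = inversion x t) *
  ((len (a * x) < len (a * t * x))%N = ~~ inversion x t).
Proof.
move=> ht lt.
have na : ~~ inversion a^-1 t.
  have e : t * a^-1 = (a * t)^-1 by rewrite invgM (reflection_inv ht).
  by rewrite inversionE // e !lenV; lia.
split; first by rewrite translate_lt // (negPf na).
have {1}-> : a * x = a * t * t * x by rewrite -(gmulA a) reflection_sq // mulg1.
rewrite translate_lt // invgM (reflection_inv ht) inversion_mull // na.
by case: (inversion x t).
Qed.

(** The new middle term is not a peak, so its translate is smaller than a x
    or than b x, both of which are smaller than c x. *)
Lemma exchange_peak a c b x : cover a c -> cover c b ->
  (len (a * x) < len (c * x))%N -> (len (b * x) < len (c * x))%N ->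
  exists c', [/\ cover a c', cover c' b & (len (c' * x) < len (c * x))%N].
Proof.
move=> ac cb; have [t ht [ec lc]] := coverP _ _ ac.
have [t' ht' [eb lb]] := coverP _ _ cb.
subst c b => lt1 lt2.
have up1 : (len a < len (a * t))%N by lia.
have up2 : (len (a * t) < len (a * t * t'))%N by lia.
have nxt : ~~ inversion x t by rewrite -(translate_up x ht up1).2.
have xt' : inversion x t' by rewrite -(translate_up x ht' up2).1.
have tt' : t != t'.
  by apply/eqP => e; move: lb; rewrite -e -(gmulA a) (reflection_sq ht) mulg1; lia.
have e1 : t * a^-1 = (a * t)^-1 by rewrite invgM (reflection_inv ht).
have e2 : t' * (t * a^-1) = (a * t * t')^-1.
  by rewrite e1 [in RHS]invgM (reflection_inv ht').
have [||||r [r' [hr hr' er lr xr]]] :=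
  @dihedral_diamond t t' ht ht' tt' _ erefl x a^-1.
- by rewrite e1 !lenV.
- by rewrite e2 e1 !lenV.
- exact: nxt.
- exact: xt'.
have eb : a * t * t' = a * r * r'.
  by apply: invg_inj; rewrite -e2 -er !invgM (reflection_inv hr) (reflection_inv hr').
have lr' : len (a * r) = (len a).+1.
  by rewrite -lenV invgM (reflection_inv hr) lr lenV.
have c1 : cover a (a * r) by apply/coverP; exists r.
have c2 : cover (a * r) (a * t * t').
  by apply/coverP; exists r' => //; split; rewrite // lr' lb lc.
exists (a * r); split=> //.
case/orP: xr => [xr|nxr'].
  have := (translate_up x hr (_ : (len a < len (a * r))%N)).1.
  rewrite xr lr' => /(_ (ltnSn _)); lia.
have := (translate_up x hr' (_ : (len (a * r) < len (a * r * r'))%N)).2.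
rewrite nxr' -eb lb lr' lc => /(_ (ltnSn _)); lia.
Qed.

(** * Chains without peaks *)

Section Valley.
Variable x : W.

Definition peak (a c b : W) : bool :=
  (len (a * x) < len (c * x))%N && (len (b * x) < len (c * x))%N.

Fixpoint peak_free (u : W) (p : seq W) : bool :=
  if p is c :: p' then
    (if p' is b :: _ then ~~ peak u c b else true) && peak_free c p'
  else true.

Lemma peak_exchange_path u p : path cover u p -> ~~ peak_free u p ->
  exists q, [/\ path cover u q, last u q = last u p
    & (\sum_(c <- q) len (c * x)%g < \sum_(c <- p) len (c * x)%g)%N].
Proof.
elim: p u => // c p IH u /= /andP[uc cp]; rewrite negb_and orbC.
case/orP => [npf|].
  have [q [cq eq lt]] := IH c cp npf; exists (c :: q).
  by rewrite /= uc cq eq !big_cons ltn_add2l.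
case: p cp {IH} => // b p /= /andP[cb bp] /negPn /andP[lt1 lt2].
have [c' [uc' c'b lt]] := exchange_peak uc cb lt1 lt2.
by exists [:: c', b & p]; rewrite /= uc' c'b bp !big_cons ltn_add2r.
Qed.

Lemma peak_free_saturated u v : saturated u v ->
  exists p, [/\ path cover u p, last u p = v & peak_free u p].
Proof.
case=> p; have [n] := ubnP (\sum_(c <- p) len (c * x)%g)%N.
elim: n p => // n IH p ltn up ep.
have [pf|npf] := boolP (peak_free u p); first by exists p.
have [q [uq eq lt]] := peak_exchange_path up npf.
by apply: (IH q) => //; [apply: leq_trans lt _ | rewrite eq].
Qed.

Lemma cover_translate a b : cover a b ->
  bruhat_step S (a * x) (b * x) \/
  bruhat_step S (b * x) (a * x) /\ (len (b * x) < len (a * x))%N.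
Proof.
move=> ab; have [t ht [eb lb]] := coverP _ _ ab; subst b.
have lt : (len a < len (a * t))%N by lia.
have e : a * t * x = a * x * (x^-1 * t * x) by rewrite !gmulA mulgK.
have e' : a * x = a * t * x * (x^-1 * t * x).
  by rewrite !gmulA mulgK -(gmulA a) reflection_sq // mulg1.
have hr : reflections S (x^-1 * t * x).
  by rewrite -{2}[x]invgK; apply: reflection_conj.
have [lt1 lt2] := translate_up x ht lt.
have [xt|nxt] := boolP (inversion x t).
  by right; split; rewrite ?lt1 //; split; rewrite ?lt1 //; exists (x^-1 * t * x).
by left; split; rewrite ?lt2 //; exists (x^-1 * t * x).
Qed.

(** Without peaks, translates that once go up keep going up. *)
Lemma peak_free_rise u c p z : path cover u (c :: p) -> peak_free u (c :: p) ->
  (len (u * x) < len (c * x))%N -> z \in c :: p ->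
  bruhat_le S (z * x) (last c p * x).
Proof.
elim: p u c z => [|b p IH] u c z /= /andP[uc cp].
  by move=> _ _; rewrite inE => /eqP->; apply: rt_refl.
case/andP => npk pf lt; have [cb bp] := andP cp.
have le : (len (c * x) <= len (b * x))%N.
  by move: npk; rewrite /peak lt /= -leqNgt.
have [cbx|[_]] := cover_translate cb; last by lia.
have IHb y := IH c b y cp pf (proj2 cbx).
rewrite inE => /predU1P[->|/IHb//].
exact: (@rt_trans _ _ _ _ _ (@rt_step _ _ _ _ cbx) (IHb b (mem_head _ _))).
Qed.

Lemma peak_free_below w u p z : path cover u p -> peak_free u p ->
  bruhat_le S (u * x) w -> bruhat_le S (last u p * x) w ->
  z \in u :: p -> bruhat_le S (z * x) w.
Proof.
elim: p u => [|c p IH] u up pf uw lw; first by rewrite inE => /eqP->.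
rewrite inE => /predU1P[->//|zp].
have [uc cp] := andP up; have [_ pf'] := andP pf.
have [[_ lt]|[st _]] := cover_translate uc.
  exact: (@rt_trans _ _ _ _ _ (peak_free_rise up pf lt zp) lw).
exact: IH cp pf' (@rt_trans _ _ _ _ _ (@rt_step _ _ _ _ st) uw) lw zp.
Qed.

End Valley.

Lemma path_cover_len u p : path cover u p -> len (last u p) = (len u + size p)%N.
Proof.
elim: p u => [|c p IH] u /=; first by rewrite addn0.
by case/andP=> /coverP[t _ [_ e]] /IH ->; rewrite e addSnnS.
Qed.

Lemma translated_lower_intervalE w x u :
  translated_lower_interval S w x u <-> bruhat_le S (u * x) w.
Proof.
split=> [[v vw <-]|uw]; first by rewrite mulgVK.
by exists (u * x); rewrite ?mulgK.
Qed.

Lemma cover_bruhat_lt u v : cover u v -> bruhat_lt S u v.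
Proof.
case/coverP=> t ht [e l]; split; last by move=> euv; move: l; rewrite euv; lia.
by apply: rt_step; split; [exists t | rewrite l].
Qed.

End Coxeter.

Theorem proposition4p13 (W : groupType) (S : set W) (hWS : coxeter_system S)
    (w x u v : W) :
  translated_lower_interval S w x u ->
  translated_lower_interval S w x v ->
  bruhat_lt S u v ->
  bruhat_chain S (translated_lower_interval S w x) u v
    (coxeter_length S v - coxeter_length S u)%N.
Proof.
move=> /translated_lower_intervalE uw /translated_lower_intervalE vw [uv _].
have [p [up ep pf]] := peak_free_saturated hWS x (bruhat_saturated_chain hWS uv).
have -> : (coxeter_length S v - coxeter_length S u)%N = size p.
  by rewrite -ep (path_cover_len up) addKn.
exists (nth u (u :: p)); split=> // [|i ip|i ip].
- by rewrite -[size p]/(size (u :: p)).-1 nth_last.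
- apply/translated_lower_intervalE; apply: (peak_free_below hWS up pf uw).
    by rewrite ep.
  by rewrite mem_nth.
- exact/cover_bruhat_lt/(pathP u up).
Qed.
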